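(* Let $J$ be the objective function defined in the context, and let $(u_{\mathrm{ff}}^\star,\Theta^\star)$ be an optimal pair, i.e. a minimizer of $J(u_{\mathrm{ff}},\Theta)$ over $(u_{\mathrm{ff}},\Theta)\in\mathbb{R}^{Nn_u}\times\mathbb{R}^{Nn_u\times(N+1)n_x}$ subject to $\mathcal{E}_{u,i}\Theta\mathcal{E}_{x,j}^{\mathrm T}=0$ for all $(i,j)\in\mathcal I$. Then the following first order necessary conditions hold: (1) $u_{\mathrm{ff}}^\star=\big(I+\lambda H_u^{\mathrm T}F^{\mathrm T}FH_u\big)^{-1}\lambda H_u^{\mathrm T}F^{\mathrm T}(\mu_d-F\Gamma\mu_0)$ (in particular, $u_{\mathrm{ff}}^\star$ is unique); (2) $\mathcal{E}_{u,i}\Theta^\star\mathcal{E}_{x,j}^{\mathrm T}=0$ for all $(i,j)\in\mathcal I$, and there exist matrices $\Psi_{i,j}\in\mathbb{R}^{n_u\times n_x}$, $(i,j)\in\mathcal I$, such that, with $\Omega^\star:=F(I+H_u\Theta^\star)$, $$2\Theta^\star\tilde S+2\lambda H_u^{\mathrm T}F^{\mathrm T}F(I+H_u\Theta^\star)\tilde S-2\lambda H_u^{\mathrm T}F^{\mathrm T}S_d^{1/2}\Big(S_d^{-1/2}\big(\Omega^\star\tilde S\Omega^{\star\mathrm T}\big)^{-1}S_d^{-1/2}\Big)^{1/2}S_d^{1/2}\,\Omega^\star\tilde S+\sum_{(i,j)\in\mathcal I}\mathcal{E}_{u,i}^{\mathrm T}\Psi_{i,j}\mathcal{E}_{x,j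}=0.$$
   Context: Setting. $N\ge 1$ is an integer (time horizon), $n_x,n_u,n_w\ge 1$, and for $k=0,\dots,N-1$ the matrices $A_k\in\mathbb{R}^{n_x\times n_x}$, $B_k\in\mathbb{R}^{n_x\times n_u}$, $G_k\in\mathbb{R}^{n_x\times n_w}$ are given, with each $G_k$ of full row rank. Also given are $\mu_0,\mu_d\in\mathbb{R}^{n_x}$, symmetric positive definite $S_0,S_d\in\mathbb{R}^{n_x\times n_x}$ and $S_w\in\mathbb{R}^{n_w\times n_w}$, and a real $\lambda>0$. Let $\Phi(n,n)=I$ and $\Phi(k,n)=A_{k-1}\cdots A_n$ for $k>n$. Define $\Gamma=[\,I_{n_x}\;\;\Phi(1,0)^{\mathrm T}\;\cdots\;\Phi(N,0)^{\mathrm T}]^{\mathrm T}\in\mathbb{R}^{(N+1)n_x\times n_x}$; $H_u\in\mathbb{R}^{(N+1)n_x\times Nn_u}$ the block matrix whose block in block-row $i\in\{0,\dots,N\}$ and block-column $j\in\{0,\dots,N-1\}$ is $\Phi(i,j+1)B_j$ if $i>j$ and $0$ otherwise; $H_w\in\mathbb{R}^{(N+1)n_x\times Nn_w}$ defined likewise with $G_j$ in place of $B_j$; $F=[0,\dots,0,I_{n_x}]\in\mathbb{R}^{n_x\times(N+1)n_x}$; $\tilde S=\Gamma S_0\Gamma^{\mathrm T}+H_w\,\mathrm{blkdiag}(S_w,\dots,S_w)\,H_w^{\mathrm T}$ (with $N$ copies of $S_w$). For $\Theta\in\mathbb{R}^{Nn_u\times(N+1)n_x}$ put $\Omega=F(I+H_u\Theta)$.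 The objective, for $u_{\mathrm{ff}}\in\mathbb{R}^{Nn_u}$, is $$J(u_{\mathrm{ff}},\Theta)=\mathrm{trace}(\Theta\tilde S\Theta^{\mathrm T})+\|u_{\mathrm{ff}}\|_2^2+\lambda\,W_2^2(u_{\mathrm{ff}},\Theta),$$ $$W_2^2(u_{\mathrm{ff}},\Theta)=\|\mu_d-F(\Gamma\mu_0+H_uu_{\mathrm{ff}})\|_2^2+\mathrm{trace}\big(\Omega\tilde S\Omega^{\mathrm T}+S_d\big)-2\,\mathrm{trace}\Big(\big(S_d^{1/2}\,\Omega\tilde S\Omega^{\mathrm T}\,S_d^{1/2}\big)^{1/2}\Big),$$ where $(\cdot)^{1/2}$ is the symmetric positive semidefinite square root. Causality constraints. $\mathcal I=\{(i,j): 0\le i\le N-1,\ 0\le j\le N,\ j>i\}$. $\mathcal{E}_{u,i}\in\mathbb{R}^{n_u\times Nn_u}$ is the block row whose $(i+1)$-th block is $I_{n_u}$ and whose other blocks are $0$; $\mathcal{E}_{x,j}\in\mathbb{R}^{n_x\times(N+1)n_x}$ is the block row whose $(j+1)$-th block is $I_{n_x}$ and whose other blocks are $0$. Thus $\mathcal{E}_{u,i}\Theta\mathcal{E}_{x,j}^{\mathrm T}$ is the $(i,j)$ block of $\Theta$. For $\Theta$ satisfying these constraints, $\Omega\tilde S\Omega^{\mathrm T}$ is positive definite. *)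

(* Defs.v *)
From mathcomp Require Import all_boot all_order all_algebra.
From mathcomp Require Import boolp classical_sets reals.

Set Implicit Arguments.
Unset Strict Implicit.
Unset Printing Implicit Defensive.

Import Order.TTheory GRing.Theory Num.Theory.
Local Open Scope ring_scope.

Definition psdmx (R : realType) (n : nat) (M : 'M[R]_n) : Prop :=
  M \is symmetricmx /\ forall v : 'cV[R]_n, 0 <= (v^T *m M *m v) 0 0.

Definition posdefmx (R : realType) (n : nat) (M : 'M[R]_n) : Prop :=
  M \is symmetricmx /\
  forall v : 'cV[R]_n, v != 0 -> 0 < (v^T *m M *m v) 0 0.

(* A positive semidefinite M has exactly one positive semidefinite square root,
   so the choice made by xget is forced; a matrix without any such square root
   is sent to 0. *)
Definition sqrtmx (R : realType) (n : nat) (M : 'M[R]_n) : 'M[R]_n :=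
  xget 0 [set S : 'M[R]_n | psdmx S /\ S *m S = M]%classic.

Definition sqnorm2 (R : realType) (n : nat) (v : 'cV[R]_n) : R :=
  \sum_(i < n) v i 0 ^+ 2.

(* Block matrices follow the \mxblock conventions: a stack of p blocks of size
   n has dimension \sum_(i < p) n (which is p * n by sum_nat_const). *)

Section StackedSystem.
Context (R : realType) (N nx nu nw : nat).
Implicit Types (A : 'I_N -> 'M[R]_nx) (B : 'I_N -> 'M[R]_(nx, nu))
  (G : 'I_N -> 'M[R]_(nx, nw)).

(* A_{k-1} *m ... *m A_n; the indices run in decreasing order because the
   product is not commutative. *)
Definition transition A (k n : nat) : 'M[R]_nx :=
  \prod_(j <- rev (enum 'I_N) | (n <= j < k)%N) A j.

Definition Gammamx A : 'M[R]_(\sum_(i < N.+1) nx, nx) :=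
  \mxcol_(i < N.+1) transition A i 0.

(* H_u is Hmx A B and H_w is Hmx A G. *)
Definition Hmx A (m : nat) (C : 'I_N -> 'M[R]_(nx, m)) :
    'M[R]_(\sum_(i < N.+1) nx, \sum_(j < N) m) :=
  \mxblock_(i < N.+1, j < N)
    (if (j < i)%N then transition A i j.+1 *m C j else 0).

Definition Fmx : 'M[R]_(nx, \sum_(j < N.+1) nx) :=
  \mxrow_(j < N.+1) (if j == ord_max then 1%:M else 0 : 'M[R]_nx).

Definition Stilde A G (S0 : 'M[R]_nx) (Sw : 'M[R]_nw) :
    'M[R]_(\sum_(i < N.+1) nx) :=
  Gammamx A *m S0 *m (Gammamx A)^T
  + Hmx A G *m (\mxdiag_(k < N) Sw) *m (Hmx A G)^T.

Definition Omegamx A B (Theta : 'M[R]_(\sum_(j < N) nu, \sum_(i < N.+1) nx)) :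
    'M[R]_(nx, \sum_(i < N.+1) nx) :=
  Fmx *m (1%:M + Hmx A B *m Theta).

Definition Wasserstein_sq A B G (mu0 mud : 'cV[R]_nx) (S0 Sd : 'M[R]_nx)
    (Sw : 'M[R]_nw) (uff : 'cV[R]_(\sum_(j < N) nu))
    (Theta : 'M[R]_(\sum_(j < N) nu, \sum_(i < N.+1) nx)) : R :=
  let Sf := Omegamx A B Theta *m Stilde A G S0 Sw *m (Omegamx A B Theta)^T in
  sqnorm2 (mud - Fmx *m (Gammamx A *m mu0 + Hmx A B *m uff))
  + \tr (Sf + Sd)
  - 2 * \tr (sqrtmx (sqrtmx Sd *m Sf *m sqrtmx Sd)).

Definition objective A B G (mu0 mud : 'cV[R]_nx) (S0 Sd : 'M[R]_nx)
    (Sw : 'M[R]_nw) (lambda : R) (uff : 'cV[R]_(\sum_(j < N) nu))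
    (Theta : 'M[R]_(\sum_(j < N) nu, \sum_(i < N.+1) nx)) : R :=
  \tr (Theta *m Stilde A G S0 Sw *m Theta^T) + sqnorm2 uff
  + lambda * Wasserstein_sq A B G mu0 mud S0 Sd Sw uff Theta.

Definition Eu (i : 'I_N) : 'M[R]_(nu, \sum_(j < N) nu) :=
  \mxrow_(j < N) (if j == i then 1%:M else 0 : 'M[R]_nu).

Definition Ex (j : 'I_N.+1) : 'M[R]_(nx, \sum_(i < N.+1) nx) :=
  \mxrow_(i < N.+1) (if i == j then 1%:M else 0 : 'M[R]_nx).

Definition causal (Theta : 'M[R]_(\sum_(j < N) nu, \sum_(i < N.+1) nx)) :
    Prop :=
  forall (i : 'I_N) (j : 'I_N.+1), (i < j)%N -> Eu i *m Theta *m (Ex j)^T = 0.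

Definition optimal_pair A B G (mu0 mud : 'cV[R]_nx) (S0 Sd : 'M[R]_nx)
    (Sw : 'M[R]_nw) (lambda : R) (uff : 'cV[R]_(\sum_(j < N) nu))
    (Theta : 'M[R]_(\sum_(j < N) nu, \sum_(i < N.+1) nx)) : Prop :=
  causal Theta /\
  forall (u : 'cV[R]_(\sum_(j < N) nu))
         (T : 'M[R]_(\sum_(j < N) nu, \sum_(i < N.+1) nx)),
    causal T ->
    objective A B G mu0 mud S0 Sd Sw lambda uff Theta
      <= objective A B G mu0 mud S0 Sd Sw lambda u T.

End StackedSystem.

Arguments Fmx {R} N nx.
Arguments Eu {R N nu} i.
Arguments Ex {R N nx} j.

(* Main.v *)
Require Import Defs.
From mathcomp Require Import all_boot all_order all_algebra.
From mathcomp Require Import boolp classical_sets reals complex ring lra.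
Set Implicit Arguments.
Unset Strict Implicit.
Unset Printing Implicit Defensive.
Import Order.TTheory GRing.Theory Num.Theory.
Local Open Scope ring_scope.

(** The objective is the sum of a strictly convex quadratic function of the
    feedforward input and of a function of the gain, so the input is determined
    by a linear system whose matrix is positive definite ([feedforward_foc],
    [feedforward_posdef]).

    For the gain the only term that is not quadratic is the multiple by -2 of
    tr ((Sd^(1/2) Omega S Omega^T Sd^(1/2))^(1/2)), with S the matrix Stilde.
    Put Y = Sd^(1/2) Omega, let Y0 be its value at the minimizer
    and let Q0 be the root of Y0 S Y0^T. Then
      tr ((Y S Y^T)^(1/2)) >= tr (Q0^-1 Y0 S Y^T),
    with equality at Y0 ([trace_root_minorant]); this is the duality between
    the nuclear and the operator norm. The right-hand side is linear in the
    gain, so the objective lies below a quadratic function that touches it at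
    the minimizer. The minimizer of the objective minimizes this quadratic
    function as well, and stationarity of the latter is the stated condition;
    the matrix square root is never differentiated ([feedback_foc]). Lagrange
    multipliers exist because the gradient is orthogonal to the causal gains
    ([causal_multipliers]).

    The bound needs invertible roots. The covariance Omega S Omega^T of the
    final state is positive definite for a causal gain, because the last
    disturbance acts on the final state through a matrix of full row rank and
    no feedback can react to it ([final_cov_posdef]). A positive definite
    matrix M has a positive definite root of the form q(M)^2, with q a real
    polynomial interpolating the fourth root on the eigenvalues
    ([posdefmx_root]), and no other positive semidefinite root
    ([psdmx_root_uniq]). *)

(** * Positive definite matrices *)

Lemma symmetricmx_trE (R : realType) n (M : 'M[R]_n) :
  M \is symmetricmx <-> M^T = M.
Proof.
rewrite is_hermitianmxE expr0 scale1r map_mx_id //.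
by split=> [/eqP <- //|->].
Qed.

Lemma posdefmx_tr (R : realType) n (M : 'M[R]_n) : posdefmx M -> M^T = M.
Proof. by case=> /symmetricmx_trE. Qed.

Lemma psdmx_tr (R : realType) n (M : 'M[R]_n) : psdmx M -> M^T = M.
Proof. by case=> /symmetricmx_trE. Qed.

Lemma posdefmx_psd (R : realType) n (M : 'M[R]_n) : posdefmx M -> psdmx M.
Proof.
case=> sM pM; split=> // v; have [->|/pM/ltW//] := eqVneq v 0.
by rewrite mulmx0 mxE.
Qed.

Lemma psdmx_congr (R : realType) m n (P : 'M[R]_n) (X : 'M[R]_(n, m)) :
  psdmx P -> psdmx (X^T *m P *m X).
Proof.
move=> [/symmetricmx_trE sP pP]; split.
  by apply/symmetricmx_trE; rewrite !trmx_mul trmxK sP mulmxA.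
by move=> v; have := pP (X *m v); rewrite trmx_mul !mulmxA.
Qed.

Lemma posdefmx_congr (R : realType) m n (P : 'M[R]_n) (X : 'M[R]_(n, m)) :
  (forall v : 'cV_m, X *m v = 0 -> v = 0) ->
  posdefmx P -> posdefmx (X^T *m P *m X).
Proof.
move=> injX pP; split; first by have [] := psdmx_congr X (posdefmx_psd pP).
move=> v v0; have := pP.2 (X *m v); rewrite trmx_mul !mulmxA; apply.
by apply: contra_neq v0; apply: injX.
Qed.

Lemma posdefmx_unit (R : realType) n (M : 'M[R]_n) :
  posdefmx M -> M \in unitmx.
Proof.
move=> pM; rewrite -row_free_unit -kermx_eq0; apply/eqP/row_matrixP => i.
rewrite row0; set u := row i _.
have uM : u *m M = 0 by rewrite -row_mul mulmx_ker row0.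
apply/trmx_inj; rewrite trmx0; apply/eqP/contraT => /pM.2.
by rewrite trmxK uM mul0mx mxE ltxx.
Qed.

Lemma invmx_mul (R : comUnitRingType) n (X Y : 'M[R]_n) :
  X \in unitmx -> Y \in unitmx -> invmx (X *m Y) = invmx Y *m invmx X.
Proof.
move=> uX uY; have uXY : X *m Y \in unitmx by rewrite unitmx_mul uX.
by apply: (can_inj (mulmxK uXY)); rewrite mulVmx // -mulmxA mulKmx // mulVmx.
Qed.

Lemma posdefmx_inv (R : realType) n (M : 'M[R]_n) :
  posdefmx M -> posdefmx (invmx M).
Proof.
move=> pM; have uM := posdefmx_unit pM.
have -> : invmx M = (invmx M)^T *m M *m invmx M.
  by rewrite trmx_inv posdefmx_tr // mulVmx // mul1mx.
by apply: posdefmx_congr => // v /(congr1 (mulmx M)); rewrite mulKVmx // mulmx0.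
Qed.

Lemma mxtrace_congr (R : realType) m n (P : 'M[R]_n) (X : 'M[R]_(n, m)) :
  \tr (X^T *m P *m X) = \sum_j ((col j X)^T *m P *m col j X) 0 0.
Proof.
apply: eq_bigr => j _.
have -> : (col j X)^T *m P *m col j X = col j (row j (X^T *m P *m X)).
  by rewrite tr_col !row_mul [RHS]colE !colE mulmxA.
by rewrite !mxE.
Qed.

Lemma psdmx_trace_ge0 (R : realType) m n (P : 'M[R]_n) (X : 'M[R]_(n, m)) :
  psdmx P -> 0 <= \tr (X^T *m P *m X).
Proof. by case=> _ pP; rewrite mxtrace_congr sumr_ge0. Qed.

Lemma posdefmx_trace_eq0 (R : realType) m n (P : 'M[R]_n) (X : 'M[R]_(n, m)) :
  posdefmx P -> \tr (X^T *m P *m X) = 0 -> X = 0.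
Proof.
move=> pP; have [_ qP] := posdefmx_psd pP.
rewrite mxtrace_congr => /eqP; rewrite psumr_eq0 // => /allP /= X0.
apply/matrixP => i j; rewrite mxE.
have /eqP/colP/(_ i) : col j X == 0; last by rewrite !mxE.
apply: contraT => /pP.2; rewrite lt0r.
by have /= := X0 j (mem_index_enum _) => /eqP->; rewrite eqxx.
Qed.

Lemma posdefmx1 (R : realType) n : posdefmx (1%:M : 'M[R]_n).
Proof.
split; first by apply/symmetricmx_trE; rewrite trmx1.
have sq_ge0 (u : 'cV[R]_n) (i : 'I_n) : true -> 0 <= u^T 0 i * u i 0.
  by rewrite mxE -expr2 sqr_ge0.
move=> u u0; rewrite mulmx1 mxE lt0r (sumr_ge0 _ (sq_ge0 u)) andbT.
apply: contra_neq u0 => /eqP; rewrite (psumr_eq0 _ (sq_ge0 u)) => /allP z.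
apply/colP => i; rewrite [RHS]mxE; apply/eqP.
by have /= := z i (mem_index_enum _); rewrite mxE mulf_eq0 orbb.
Qed.

(** * The square root of a positive definite matrix *)

(** The spectral theorem over the complex numbers makes a real symmetric matrix
    diagonalizable; its diagonal entries are real eigenvalues, and a polynomial
    vanishing on all of them annihilates the matrix. *)
Lemma symmetric_annihilator (R : realType) n (M : 'M[R]_n.+1) :
  M^T = M ->
  exists2 s : seq R, {in s, forall a, eigenvalue M a} &
    forall p : {poly R}, {in s, forall a, root p a} -> horner_mx M p = 0.
Proof.
move=> sM; pose f := real_complex R; pose MC := map_mx f M.
have hMC : MC \is hermsymmx.
  apply: realsym_hermsym.
    by rewrite is_hermitianmxE expr0 scale1r map_mx_id // map_trmx sM.
  by apply/mxOverP => i j; rewrite mxE; apply/complex_realP; exists (M i j).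
have /orthomx_spectralP defM := hermitian_normalmx hMC.
have /mxOverP dreal := hermitian_spectral_diag_real hMC.
move: (spectral_unit MC) defM dreal.
set P := spectralmx MC; set d := spectral_diag MC => uP defM dreal.
pose e i := complex.Re (d 0 i).
have eE i : d 0 i = f (e i) by rewrite /e /f RRe_real.
exists [seq e i | i : 'I_n.+1] => [a /mapP[i _ ->]|p rp].
  suff: eigenvalue MC (d 0 i).
    by rewrite !eigenvalue_root_char eE -(fmorph_root f) map_char_poly.
  apply/eigenvalueP; exists (row i P).
    rewrite {1}defM !mulmxA -row_mul mulmxV //.
    by rewrite row1 -rowE row_diag_mx -scalemxAl -rowE.
  apply/eqP => /(congr1 (mulmx^~ (invmx P))); rewrite -row_mul mulmxV // mul0mx.
  by move/rowP/(_ i)/eqP; rewrite !mxE eqxx oner_eq0.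
apply/(map_mx_inj (f := f)); rewrite map_horner_mx map_mx0 -/MC defM.
rewrite -{2}[P]invmxK horner_mx_uconj ?unitmx_inv // horner_mx_diag.
suff -> : map_mx (horner (map_poly f p)) d = 0.
  by rewrite raddf0 mulmx0 mul0mx.
apply/rowP => i; rewrite !mxE eE horner_map.
by have /eqP-> : root p (e i) by apply/rp/map_f; rewrite mem_enum.
Qed.

Lemma interpolation (F : fieldType) (f : F -> F) (s : seq F) :
  exists q : {poly F}, {in s, forall x, q.[x] = f x}.
Proof.
elim: s => [|a s [q qs]]; first by exists 0.
have [a_s|a_s] := boolP (a \in s).
  by exists q => x; rewrite inE => /orP[/eqP->|]; apply: qs.
pose w : {poly F} := \prod_(b <- s) ('X - b%:P).
have wa : w.[a] != 0.
  by rewrite -rootE /w root_prod_XsubC.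
exists (q + ((f a - q.[a]) / w.[a]) *: w) => x.
rewrite inE !hornerE => /orP[/eqP->|xs]; first by rewrite divfK // subrKC.
have /eqP-> : root w x by rewrite /w root_prod_XsubC.
by rewrite mulr0 addr0 qs.
Qed.

(** A polynomial q taking the value a^(1/4) at each eigenvalue a of M gives
    q(M)^4 = M, so q(M)^2 = q(M)^T q(M) is a root of M whose positivity is
    visible. *)
Lemma posdefmx_root (R : realType) n (M : 'M[R]_n) :
  posdefmx M -> exists2 S : 'M[R]_n, posdefmx S & S *m S = M.
Proof.
case: n M => [|n] M pM; first by exists M; rewrite // (flatmx0 M) mulmx0.
have sM := posdefmx_tr pM; have [s eigs ann] := symmetric_annihilator sM.
have [q qs] := interpolation (fun a => Num.sqrt (Num.sqrt a)) s.
pose Q := horner_mx M q.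
have QE : Q ^+ 4 = M.
  apply/eqP; rewrite -subr_eq0 -[X in _ - X](horner_mx_X M) /Q -rmorphXn -rmorphB.
  apply/eqP.
  apply: ann => a a_s; rewrite rootE !hornerE qs // (exprM _ 2 2).
  rewrite !sqr_sqrtr ?sqrtr_ge0 //; first by rewrite subrr.
  (* It remains to see that the eigenvalue a of M is nonnegative. *)
  have /eigenvalueP[v vM v0] := eigs _ a_s.
  have vT0 : v^T != 0.
    by apply: contra_neq v0 => /(congr1 trmx); rewrite trmxK trmx0.
  have := pM.2 _ vT0; rewrite trmxK vM -scalemxAl mxE.
  by have := (posdefmx1 R n.+1).2 _ vT0; rewrite trmxK mulmx1 => /pmulr_lgt0-> /ltW.
have QT : Q^T = Q.
  rewrite /Q; elim/poly_ind: q {qs Q QE} => [|q c IH].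
    by rewrite !rmorph0 trmx0.
  rewrite !(rmorphD, rmorphM) /= horner_mx_X horner_mx_C linearD /= trmx_mul IH.
  by rewrite tr_scalar_mx sM; congr (_ + _); apply: comm_mx_horner.
exists (Q *m Q); last by rewrite -[RHS]QE !exprS expr0 mulr1 -!mulmxA.
have -> : Q *m Q = Q^T *m 1%:M *m Q by rewrite QT mulmx1.
apply: posdefmx_congr; last exact: posdefmx1.
move=> v Qv; have := mulKmx (posdefmx_unit pM) v.
by rewrite -[M in M *m v]QE exprSr -mulmxA Qv !mulmx0.
Qed.

(** If S and T are two roots and D = S - T, then S D + D T = 0; multiplying by
    D and taking traces gives tr (D S D) + tr (D T D) = 0, a sum of nonnegative
    terms. *)
Lemma psdmx_root_uniq (R : realType) n (S T : 'M[R]_n) :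
  posdefmx S -> psdmx T -> S *m S = T *m T -> S = T.
Proof.
move=> pS pT ST; apply/eqP; rewrite -subr_eq0; apply/eqP.
set D := S - T; have DT : D^T = D.
  by rewrite /D linearB /= posdefmx_tr // psdmx_tr.
have SD_DT : S *m D + D *m T = 0.
  by rewrite /D mulmxBr mulmxBl ST addrA subrK subrr.
have tr0 : \tr (D^T *m S *m D) + \tr (D^T *m T *m D) = 0.
  rewrite DT -(mulmxA D T) [X in _ + X]mxtrace_mulC -!mulmxA.
  by rewrite (mxtrace_mulC T) -mulmxA -linearD -mulmxDr SD_DT mulmx0 linear0.
apply: (posdefmx_trace_eq0 pS); move: tr0 (psdmx_trace_ge0 D pT).
by move: (psdmx_trace_ge0 D (posdefmx_psd pS)); lra.
Qed.

Lemma sqrtmx_eq (R : realType) n (M S : 'M[R]_n) :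
  posdefmx S -> S *m S = M -> sqrtmx M = S.
Proof.
move=> pS SM; apply: xget_unique; first by split; first exact: posdefmx_psd.
by move=> T [pT TM]; apply/esym/psdmx_root_uniq; rewrite // SM TM.
Qed.

Lemma sqrtmxP (R : realType) n (M : 'M[R]_n) :
  posdefmx M -> posdefmx (sqrtmx M) /\ sqrtmx M *m sqrtmx M = M.
Proof. by move=> /posdefmx_root[S pS SM]; rewrite (sqrtmx_eq pS SM). Qed.

Lemma sqrtmx_inv (R : realType) n (M : 'M[R]_n) :
  posdefmx M -> sqrtmx (invmx M) = invmx (sqrtmx M).
Proof.
move=> /sqrtmxP[pS SM]; have uS := posdefmx_unit pS.
apply: sqrtmx_eq; first exact: posdefmx_inv.
apply: (can_inj (mulmxK uS)); rewrite mulmxKV //.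
apply: (can_inj (mulmxK uS)); rewrite mulVmx // -mulmxA SM mulVmx //.
by rewrite -SM unitmx_mul uS.
Qed.

(** * Trace bounds *)

Lemma trace_posdef_mul_ge0 (R : realType) m n (P : 'M[R]_n) (K : 'M[R]_m)
    (Z : 'M[R]_(n, m)) :
  posdefmx P -> psdmx K -> 0 <= \tr (P *m (Z *m K *m Z^T)).
Proof.
move=> /sqrtmxP[pS <-] pK; set S := sqrtmx P in pS *.
have := psdmx_trace_ge0 (Z^T *m S) pK.
rewrite trmx_mul trmxK posdefmx_tr // (mxtrace_mulC (S *m S)) !mulmxA.
by rewrite mxtrace_mulC !mulmxA.
Qed.

(** With Z = Y - Q Q0^-1 Y0, the nonnegative number tr (Q^-1 Z K Z^T) equals
    2 tr Q minus twice the left-hand side. The bound is an equality for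
    Y = Y0, so the trace of the square root of Y K Y^T has a minorant, linear
    in Y, that touches it at Y0. *)
Lemma trace_root_minorant (R : realType) m n (K : 'M[R]_m) (Y0 Y : 'M[R]_(n, m))
    (Q0 Q : 'M[R]_n) :
  psdmx K -> posdefmx Q0 -> posdefmx Q ->
  Q0 *m Q0 = Y0 *m K *m Y0^T -> Q *m Q = Y *m K *m Y^T ->
  \tr (invmx Q0 *m (Y0 *m K *m Y^T)) <= \tr Q.
Proof.
move=> pK pQ0 pQ Q0E QE.
have uQ0 := posdefmx_unit pQ0; have uQ := posdefmx_unit pQ.
have := trace_posdef_mul_ge0 (Y - Q *m invmx Q0 *m Y0) (posdefmx_inv pQ) pK.
have -> : invmx Q *m
    ((Y - Q *m invmx Q0 *m Y0) *m K *m (Y - Q *m invmx Q0 *m Y0)^T)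
    = Q - invmx Q *m (Y *m K *m Y0^T *m invmx Q0) *m Q
      - invmx Q0 *m (Y0 *m K *m Y^T) + Q.
  rewrite linearB /= !trmx_mul trmx_inv (posdefmx_tr pQ0) (posdefmx_tr pQ).
  have -> : Q *m invmx Q0 *m Y0 = Q *m (invmx Q0 *m Y0) by rewrite mulmxA.
  rewrite !mulmxBl !mulmxBr -QE.
  have -> : Q *m (invmx Q0 *m Y0) *m K *m (Y0^T *m (invmx Q0 *m Q)) = Q *m Q.
    rewrite !mulmxA -(mulmxA _ K) -(mulmxA _ Y0) -(mulmxA _ (Y0 *m _)).
    by rewrite [Y0 *m (K *m _)]mulmxA -Q0E -!mulmxA mulKVmx // mulKmx.
  by rewrite -!mulmxA !mulKmx // !mulmxA opprB [RHS]addrAC addrA.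
rewrite !(linearD, linearN) /= (mxtrace_mulC _ Q) mulKVmx //.
have <- :
    \tr (invmx Q0 *m (Y0 *m K *m Y^T)) = \tr (Y *m K *m Y0^T *m invmx Q0).
  rewrite -mxtrace_tr !trmx_mul trmxK trmx_inv (posdefmx_tr pQ0) (psdmx_tr pK).
  by rewrite !mulmxA.
by lra.
Qed.

(** * Quadratic perturbations *)

Lemma linear_coef_eq0 (F : realFieldType) (a b : F) :
  (forall t, 0 <= t * a + t ^+ 2 * b) -> a = 0.
Proof.
move=> ab; apply/eqP/contraT => a0.
pose c := `|b| + 1; have c0 : 0 < c by rewrite ltr_wpDl.
have bc : b < c by rewrite ltr_pwDr // ler_norm.
(* A point at which the quadratic function is negative unless a = 0. *)
have := ab (- a / c).
have -> : - a / c * a + (- a / c) ^+ 2 * b = (a / c) ^+ 2 * (b - c).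
  by field; rewrite gt_eqF.
rewrite leNgt pmulr_rlt0 ?subr_lt0 ?bc //.
by rewrite exprn_even_gt0 //= mulf_neq0 // invr_neq0 // gt_eqF.
Qed.

Lemma trace_congr_perturb (R : realType) m n (K : 'M[R]_m) (X D : 'M[R]_(n, m))
    (t : R) :
  K^T = K ->
  \tr ((X + t *: D) *m K *m (X + t *: D)^T) =
  \tr (X *m K *m X^T) + t * (2 * \tr (D^T *m (X *m K)))
  + t ^+ 2 * \tr (D *m K *m D^T).
Proof.
move=> sK; rewrite linearD /= linearZ /= !mulmxDl !mulmxDr.
rewrite -!scalemxAl -!scalemxAr !linearD /= !linearZ /=.
have -> : \tr (D *m K *m X^T) = \tr (D^T *m (X *m K)).
  by rewrite -mxtrace_tr !trmx_mul trmxK sK mulmxA mxtrace_mulC.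
by rewrite (mxtrace_mulC (X *m K) D^T); ring.
Qed.

Lemma trace_linear_perturb (R : realType) m n p q (P : 'M[R]_(n, m))
    (X : 'M[R]_(m, p)) (S : 'M[R]_(n, q)) (W V : 'M[R]_(q, p)) t :
  \tr (P *m (X *m (S *m (W + t *: V))^T)) =
  \tr (P *m (X *m (S *m W)^T)) + t * \tr (P *m (X *m (S *m V)^T)).
Proof.
rewrite mulmxDr linearD -scalemxAr linearZ /= !mulmxDr -!scalemxAr.
by rewrite linearD linearZ.
Qed.

Lemma sqnorm2E (R : realType) n (v : 'cV[R]_n) :
  sqnorm2 v = \tr (v *m 1%:M *m v^T).
Proof.
rewrite mulmx1; apply: eq_bigr => i _.
by rewrite mxE big_ord1 mxE expr2.
Qed.

Lemma sqnorm2_perturb (R : realType) n (x d : 'cV[R]_n) (t : R) :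
  sqnorm2 (x + t *: d) =
  sqnorm2 x + t * (2 * \tr (d^T *m x)) + t ^+ 2 * sqnorm2 d.
Proof. by rewrite !sqnorm2E trace_congr_perturb ?trmx1 // mulmx1. Qed.

Lemma trace_sq_eq0 (R : realType) m n (X : 'M[R]_(n, m)) :
  \tr (X^T *m X) = 0 -> X = 0.
Proof.
by move=> X0; apply: (posdefmx_trace_eq0 (posdefmx1 R n)); rewrite mulmx1.
Qed.

(** * Block rows *)

Lemma Eu_mxcol (R : realType) p n m (C : 'I_p -> 'M[R]_(n, m)) (i : 'I_p) :
  Eu i *m (\mxcol_(j < p) C j) = C i.
Proof.
rewrite mul_mxrow_mxcol (bigD1 i) //= eqxx mul1mx big1 ?addr0 // => j.
by move/negPf->; rewrite mul0mx.
Qed.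

Lemma tr_Eu (R : realType) p n (i : 'I_p) :
  (@Eu R p n i)^T = \mxcol_(j < p) (if j == i then 1%:M else 0 : 'M[R]_n).
Proof.
rewrite tr_mxrow; apply/eq_mxcol => j.
by case: eqP; rewrite ?trmx1 ?trmx0.
Qed.

Lemma Eu_tr_Eu (R : realType) p n (i j : 'I_p) :
  @Eu R p n i *m (Eu j)^T = if i == j then 1%:M else 0.
Proof. by rewrite tr_Eu Eu_mxcol. Qed.

Lemma mxcol_Eu (R : realType) p n m (X : 'M[R]_(\sum_(i < p) n, m)) :
  X = \mxcol_(i < p) (Eu i *m X).
Proof.
rewrite -{1}[X]submxcolK; apply/eq_mxcol => i.
by rewrite -{2}[X]submxcolK Eu_mxcol.
Qed.

Lemma mxdiag_quad (R : realType) p n (D : 'M[R]_n) (z : 'cV[R]_(\sum_(i < p) n)) :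
  z^T *m (\mxdiag_(i < p) D) *m z =
  \sum_(i < p) (Eu i *m z)^T *m D *m (Eu i *m z).
Proof.
rewrite {1 2}[z]mxcol_Eu -mulmxA mul_mxdiag_mxcol tr_mxcol mul_mxrow_mxcol.
by apply: eq_bigr => i _; rewrite mulmxA.
Qed.

(** All selectors are instances of one block row, so the lemmas on Eu serve for
    states and inputs alike. *)
Lemma Ex_Eu (R : realType) N nx (j : 'I_N.+1) : @Ex R N nx j = Eu j.
Proof. by []. Qed.

Lemma Fmx_Eu (R : realType) N nx : Fmx N nx = Eu ord_max :> 'M[R]_(nx, _).
Proof. by []. Qed.

(** * Positive definiteness of the final covariance *)

Lemma transition_id (R : realType) N nx (A : 'I_N -> 'M[R]_nx) n :
  transition A n n = 1%:M.
Proof.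
rewrite /transition big_pred0 // => j.
by apply/negP => /andP[/leq_ltn_trans h /h]; rewrite ltnn.
Qed.

(** An input at step j influences the states after j only, so the last one
    reaches only the final state, where the transition matrix is the
    identity. *)
Lemma Hmx_last_col (R : realType) N nx m (A : 'I_N.+1 -> 'M[R]_nx)
    (C : 'I_N.+1 -> 'M[R]_(nx, m)) :
  Hmx A C *m (Eu ord_max)^T = (Fmx N.+1 nx)^T *m C ord_max.
Proof.
rewrite tr_Eu mul_mxblock_mxrow Fmx_Eu tr_Eu mxcol_mul; apply/eq_mxcol => i.
rewrite (bigD1 ord_max) //= eqxx mulmx1 big1 ?addr0; last first.
  by move=> j /negPf->; rewrite mulmx0.
case: eqP => [->|/eqP ne] /=; first by rewrite ltnSn transition_id.
rewrite mul0mx ifF //; apply/negbTE; rewrite -leqNgt -ltnS ltn_neqAle.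
by rewrite (ne : val i != N.+1) -ltnS ltn_ord.
Qed.

(** Causality makes the feedback part of Omega strictly block lower triangular,
    so the final block of Omega is the identity. *)
Lemma Omega_last_block (R : realType) N nx nu (A : 'I_N -> 'M[R]_nx)
    (B : 'I_N -> 'M[R]_(nx, nu)) T :
  causal T -> Omegamx A B T *m (Fmx N nx)^T = 1%:M.
Proof.
move=> cT; rewrite /Omegamx mulmxDr mulmx1 mulmxDl {1 2}Fmx_Eu Eu_tr_Eu eqxx.
rewrite -[RHS]addr0; congr (_ + _).
rewrite mulmxA -mulmxA mul_mxrow_mxblock [T *m _]mxcol_Eu mul_mxrow_mxcol.
apply: big1 => k _; rewrite [Eu k *m _]mulmxA.
by rewrite [Eu k *m T *m _](cT k ord_max (ltn_ord k)) mulmx0.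
Qed.

Lemma mxdiag_psd (R : realType) p n (D : 'M[R]_n) :
  psdmx D -> psdmx (\mxdiag_(i < p) D).
Proof.
move=> [/symmetricmx_trE sD pD]; split.
  by apply/symmetricmx_trE; rewrite tr_mxdiag sD.
by move=> v; rewrite mxdiag_quad summxE sumr_ge0.
Qed.

Lemma Stilde_psd (R : realType) N nx nw (A : 'I_N -> 'M[R]_nx)
    (G : 'I_N -> 'M[R]_(nx, nw)) S0 Sw :
  posdefmx S0 -> posdefmx Sw -> psdmx (Stilde A G S0 Sw).
Proof.
move=> pS0 pSw.
have [/symmetricmx_trE s1 p1] := psdmx_congr (Gammamx A)^T (posdefmx_psd pS0).
have [/symmetricmx_trE s2 p2] :=
  psdmx_congr (Hmx A G)^T (mxdiag_psd N (posdefmx_psd pSw)).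
rewrite !trmxK in s1 p1 s2 p2; split.
  by apply/symmetricmx_trE; rewrite /Stilde linearD /= s1 s2.
by move=> v; rewrite /Stilde mulmxDr mulmxDl mxE addr_ge0.
Qed.

(** For w = Omega^T v, the quadratic form of Stilde at w is at
    least the contribution of the last disturbance, which is the form of Sw at
    G^T v; it is positive because the rows of G are independent. *)
Lemma final_cov_posdef (R : realType) N nx nu nw (A : 'I_N -> 'M[R]_nx)
    (B : 'I_N -> 'M[R]_(nx, nu)) (G : 'I_N -> 'M[R]_(nx, nw)) S0 Sw T :
  (0 < N)%N -> (forall k, row_free (G k)) -> posdefmx S0 -> posdefmx Sw ->
  causal T ->
  posdefmx (Omegamx A B T *m Stilde A G S0 Sw *m (Omegamx A B T)^T).
Proof.
case: N A B G T => // N A B G T _ Gfree pS0 pSw cT.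
move: (Omegamx A B T) (Omega_last_block A B cT) => Om OmF.
have [sS _] := psdmx_congr Om^T (Stilde_psd A G pS0 pSw).
rewrite trmxK in sS; split=> // v v0.
pose w := Om^T *m v; pose z := (Hmx A G)^T *m w.
have zE : Eu ord_max *m z = (G ord_max)^T *m v.
  rewrite /z /w !mulmxA -[Eu ord_max]trmxK -trmx_mul Hmx_last_col trmx_mul trmxK.
  rewrite -(mulmxA (G _)^T) -[Fmx _ _]trmxK.
  by rewrite -trmx_mul OmF trmx1 mulmx1.
have -> : v^T *m (Om *m Stilde A G S0 Sw *m Om^T) *m v =
    w^T *m (Gammamx A *m S0 *m (Gammamx A)^T) *m w
    + z^T *m (\mxdiag_(k < N.+1) Sw) *m z.
  have -> : z^T = w^T *m Hmx A G by rewrite trmx_mul trmxK.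
  have wE : v^T *m Om = w^T by rewrite trmx_mul trmxK.
  by rewrite !mulmxA wE -(mulmxA _ Om^T) -/w /Stilde mulmxDr mulmxDl /z !mulmxA.
rewrite mxE ltr_wpDl //.
  have [_] := psdmx_congr (Gammamx A)^T (posdefmx_psd pS0).
  by rewrite trmxK; apply.
rewrite mxdiag_quad summxE (bigD1 ord_max) //= ltr_wpDr //.
  by apply: sumr_ge0 => k _; apply: (posdefmx_psd pSw).2.
rewrite zE; apply: pSw.2; apply: contra_neq v0 => /(congr1 trmx).
rewrite trmx_mul trmxK trmx0 => /eqP; rewrite mulmx_free_eq0 // => /eqP.
by move/(congr1 trmx); rewrite trmxK trmx0.
Qed.

(** * Multipliers for the causality constraints *)

(** The multipliers cancel the noncausal blocks of X. What remains is causal,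
    and orthogonal to X by hypothesis and to the multiplier terms by causality,
    hence orthogonal to itself. *)
Lemma causal_multipliers (R : realType) N nx nu
    (X : 'M[R]_(\sum_(j < N) nu, \sum_(i < N.+1) nx)) :
  (forall D, causal D -> \tr (D^T *m X) = 0) ->
  exists Psi : 'I_N -> 'I_N.+1 -> 'M[R]_(nu, nx),
    X + \sum_(i < N) \sum_(j < N.+1 | (i < j)%N)
          ((Eu i)^T *m Psi i j *m Ex j) = 0.
Proof.
move=> orthoX; pose Psi i j : 'M[R]_(nu, nx) := - (Eu i *m X *m (Ex j)^T).
exists Psi; set M := \sum_(i < N) _.
have cD : causal (X + M).
  move=> i j ij; rewrite mulmxDr mulmxDl.
  suff -> : Eu i *m M *m (Ex j)^T = Psi i j by rewrite subrr.
  have ortho i' j' : Eu i *m ((Eu i')^T *m Psi i' j' *m Ex j') *m (Ex j)^T =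
      if (i == i') && (j == j') then Psi i j else 0.
    rewrite !mulmxA Eu_tr_Eu -mulmxA !Ex_Eu Eu_tr_Eu.
    rewrite (eq_sym j'); case: eqVneq => [<-|_]; last by rewrite !mul0mx.
    by case: eqVneq => [<-|_]; rewrite ?mulmx0 // mul1mx mulmx1.
  rewrite /M mulmx_sumr mulmx_suml (bigD1 i) //=.
  rewrite mulmx_sumr mulmx_suml (bigD1 j) //=.
  rewrite ortho !eqxx big1 ?addr0 => [|j' /andP[_ /negPf j'j]]; last first.
    by rewrite ortho (eq_sym j) j'j andbF.
  rewrite big1 ?addr0 // => i' /negPf i'i.
  rewrite mulmx_sumr mulmx_suml big1 // => j' _.
  by rewrite ortho (eq_sym i) i'i.
apply: trace_sq_eq0; rewrite mulmxDr linearD /= orthoX // add0r.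
rewrite /M mulmx_sumr linear_sum big1 //= => i _.
rewrite mulmx_sumr linear_sum big1 //= => j ij.
have D0 : Ex j *m (X + M)^T *m (Eu i)^T = 0.
  by apply/trmx_inj; rewrite !trmx_mul !trmxK trmx0 mulmxA cD.
by rewrite mulmxA mxtrace_mulC !mulmxA D0 mul0mx linear0.
Qed.

Section FirstOrderConditions.
Context (R : realType) (N nx nu nw : nat).
Variables (A : 'I_N -> 'M[R]_nx) (B : 'I_N -> 'M[R]_(nx, nu)).
Variables (G : 'I_N -> 'M[R]_(nx, nw)) (mu0 mud : 'cV[R]_nx).
Variables (S0 Sd : 'M[R]_nx) (Sw : 'M[R]_nw) (lambda : R).
Hypotheses (N_gt0 : (0 < N)%N) (G_free : forall k, row_free (G k)).
Hypotheses (S0_pd : posdefmx S0) (Sd_pd : posdefmx Sd) (Sw_pd : posdefmx Sw).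
Hypothesis lambda_gt0 : 0 < lambda.

Local Notation F := (Fmx N nx).
Local Notation Gamma := (Gammamx A).
Local Notation Hu := (Hmx A B).
Local Notation St := (Stilde A G S0 Sw).
Local Notation Om := (Omegamx A B).
Local Notation Sdh := (sqrtmx Sd).
Local Notation J := (objective A B G mu0 mud S0 Sd Sw lambda).
Local Notation optimal := (optimal_pair A B G mu0 mud S0 Sd Sw lambda).
Local Notation K := (1%:M + lambda *: (Hu^T *m F^T *m F *m Hu)).

(** * The feedforward input *)

Lemma feedforward_posdef : posdefmx K.
Proof.
have [s p] := psdmx_congr (F *m Hu) (posdefmx_psd (posdefmx1 R nx)).
rewrite mulmx1 trmx_mul mulmxA in s p; move/symmetricmx_trE: s => s; split.
  by apply/symmetricmx_trE; rewrite linearD linearZ /= trmx1 s.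
move=> v v0; rewrite mulmxDr mulmxDl -scalemxAr -scalemxAl mxE ltr_wpDr //.
  by rewrite mxE mulr_ge0 ?p // ltW.
exact: (posdefmx1 _ _).2.
Qed.

(** For a fixed gain the objective is, up to a constant, the quadratic function
    |u|^2 + lambda |mud - F (Gamma mu0 + Hu u)|^2, whose stationarity equation
    is linear. *)
Lemma feedforward_foc u T :
  optimal u T ->
  K *m u = lambda *: (Hu^T *m F^T) *m (mud - F *m Gamma *m mu0).
Proof.
move=> [cT opt]; pose c := mud - F *m (Gamma *m mu0 + Hu *m u).
pose g := u - lambda *: (Hu^T *m F^T *m c).
have g0 : g = 0.
  apply: trace_sq_eq0.
  suff /eqP : 2 * \tr (g^T *m g) = 0 by rewrite mulf_eq0 pnatr_eq0 => /eqP.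
  (* g is half the gradient at u, so its linear coefficient is 2 |g|^2. *)
  apply: (linear_coef_eq0 (b := sqnorm2 g + lambda * sqnorm2 (F *m Hu *m g))) => t.
  have := opt (u + t *: g) T cT; rewrite /objective /Wasserstein_sq -/c.
  have cE v : mud - F *m (Gamma *m mu0 + Hu *m (u + t *: v))
      = c + t *: - (F *m Hu *m v).
    by rewrite /c !mulmxDr -!scalemxAr scalerN !mulmxA !opprD !addrA.
  rewrite cE !sqnorm2_perturb.
  have -> : sqnorm2 (- (F *m Hu *m g)) = sqnorm2 (F *m Hu *m g).
    by apply: eq_bigr => i _; rewrite mxE sqrrN.
  have gE v : \tr (v^T *m g) =
      \tr (v^T *m u) + lambda * \tr ((- (F *m Hu *m v))^T *m c).
    rewrite /g; move: (c) => c'.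
    rewrite mulmxBr linearB /= -scalemxAr linearZ /= [(- _)^T]linearN /=.
    by rewrite mulNmx [X in _ + _ * X]linearN /= mulrN !trmx_mul !mulmxA.
  by rewrite gE; lra.
have uE : u = lambda *: (Hu^T *m F^T *m c).
  by apply/eqP; rewrite -subr_eq0 -/g g0.
rewrite mulmxDl mul1mx {1}uE -!scalemxAl -scalerDr; congr (_ *: _).
by rewrite /c !mulmxBr !mulmxDr !mulmxA opprD addrA subrK.
Qed.

(** * The feedback gain *)

Lemma causal_add_scale T D t :
  @causal R N nx nu T -> causal D -> causal (T + t *: D).
Proof.
move=> cT cD i j ij; rewrite mulmxDr mulmxDl -scalemxAr -scalemxAl cT // cD //.
by rewrite scaler0 addr0.
Qed.

Lemma Omega_add_scale T D t : Om (T + t *: D) = Om T + t *: (F *m Hu *m D).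
Proof. by rewrite /Omegamx -mulmxA !mulmxDr -!scalemxAr addrA. Qed.

Lemma weighted_cov_posdef T : causal T ->
  posdefmx ((Sdh *m Om T) *m St *m (Sdh *m Om T)^T).
Proof.
move=> cT; have [pS _] := sqrtmxP Sd_pd.
have -> : (Sdh *m Om T) *m St *m (Sdh *m Om T)^T
    = Sdh^T *m (Om T *m St *m (Om T)^T) *m Sdh.
  by rewrite trmx_mul (posdefmx_tr pS) !mulmxA.
apply: posdefmx_congr; last exact: final_cov_posdef.
by move=> v Sv; rewrite -[v](mulKmx (posdefmx_unit pS)) Sv mulmx0.
Qed.

(** Replacing the trace of the square root by its linear minorant bounds the
    objective above by a quadratic function of the gain with the same value at
    the minimizer; the minimizer of the objective thus minimizes this quadratic
    function, and the linear part of its expansion vanishes. *)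
Lemma feedback_foc u T :
  optimal u T -> forall D, causal D ->
  \tr (D^T *m (2 *: (T *m St)
        + (2 * lambda) *: (Hu^T *m F^T *m F *m (1%:M + Hu *m T) *m St)
        - (2 * lambda) *: (Hu^T *m F^T *m Sdh
            *m sqrtmx (invmx Sdh *m invmx (Om T *m St *m (Om T)^T) *m invmx Sdh)
            *m Sdh *m Om T *m St))) = 0.
Proof.
move=> [cT opt] D cD; have [pS _] := sqrtmxP Sd_pd; have uS := posdefmx_unit pS.
have covE X : Sdh *m (X *m St *m X^T) *m Sdh = Sdh *m X *m St *m (Sdh *m X)^T.
  by rewrite trmx_mul (posdefmx_tr pS) !mulmxA.
have pC : posdefmx (Om T *m St *m (Om T)^T) by apply: final_cov_posdef.
have uC := posdefmx_unit pC.
pose Y := Sdh *m Om T; pose V := F *m Hu *m D.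
have pY : posdefmx (Y *m St *m Y^T) := weighted_cov_posdef cT.
have [pQ QE] := sqrtmxP pY; set Q := sqrtmx (Y *m St *m Y^T) in pQ QE.
have -> :
    sqrtmx (invmx Sdh *m invmx (Om T *m St *m (Om T)^T) *m invmx Sdh) = invmx Q.
  rewrite -(sqrtmx_inv pY); congr sqrtmx.
  rewrite /Y -covE; move: (Om T *m St *m (Om T)^T) uC => C uC.
  by rewrite !invmx_mul ?unitmx_mul ?uS ?uC // mulmxA.
have psdSt : psdmx St := Stilde_psd A G S0_pd Sw_pd.
have sSt := psdmx_tr psdSt.
pose a := 2 * \tr (D^T *m (T *m St)) + 2 * lambda * \tr (V^T *m (Om T *m St))
  - 2 * lambda * \tr (invmx Q *m (Y *m St *m (Sdh *m V)^T)).
set grad := \tr _; have -> : grad = a.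
  rewrite /grad /a mulmxBr [D^T *m (_ + _)]mulmxDr linearB linearD /=.
  rewrite -!scalemxAr !linearZ /=.
  congr (_ + _ * _ - _ * _); first by rewrite /V !trmx_mul /Omegamx !mulmxA.
  rewrite [invmx Q *m (_ *m (_ *m _)^T)]mulmxA [RHS]mxtrace_mulC.
  by rewrite /V /Y !trmx_mul (posdefmx_tr pS) !mulmxA.
apply: (linear_coef_eq0
  (b := \tr (D *m St *m D^T) + lambda * \tr (V *m St *m V^T))) => t.
have := opt u (T + t *: D) (causal_add_scale t cT cD).
rewrite /objective /Wasserstein_sq !covE -/Y -/Q.
have pYt := weighted_cov_posdef (causal_add_scale t cT cD).
have [pQt QtE] := sqrtmxP pYt.
have := trace_root_minorant psdSt pQ pQt QE QtE.
(* From here on the root at T + t D enters only through its minorant. *)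
move: (sqrtmx (Sdh *m Om (T + t *: D) *m St *m _)) {pYt pQt QtE} => Qt.
rewrite Omega_add_scale -/V !mxtraceD !trace_congr_perturb //.
rewrite trace_linear_perturb -/Y -QE mulKmx ?posdefmx_unit //.
rewrite -(ler_pM2l lambda_gt0) /a; lra.
Qed.

End FirstOrderConditions.

Theorem mainTheorem4 (R : realType) (N nx nu nw : nat)
    (N_ge1 : (1 <= N)%N) (nx_ge1 : (1 <= nx)%N) (nu_ge1 : (1 <= nu)%N)
    (nw_ge1 : (1 <= nw)%N)
    (A : 'I_N -> 'M[R]_nx) (B : 'I_N -> 'M[R]_(nx, nu))
    (G : 'I_N -> 'M[R]_(nx, nw)) (G_full : forall k, row_free (G k))
    (mu0 mud : 'cV[R]_nx) (S0 Sd : 'M[R]_nx) (Sw : 'M[R]_nw)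
    (S0_pd : posdefmx S0) (Sd_pd : posdefmx Sd) (Sw_pd : posdefmx Sw)
    (lambda : R) (lambda_gt0 : 0 < lambda)
    (ustar : 'cV[R]_(\sum_(j < N) nu))
    (Tstar : 'M[R]_(\sum_(j < N) nu, \sum_(i < N.+1) nx))
    (opt : optimal_pair A B G mu0 mud S0 Sd Sw lambda ustar Tstar) :
  let F := Fmx N nx in
  let Gamma := Gammamx A in
  let Hu := Hmx A B in
  let St := Stilde A G S0 Sw in
  let Om := Omegamx A B Tstar in
  let Sdh := sqrtmx Sd in
  let K := 1%:M + lambda *: (Hu^T *m F^T *m F *m Hu) in
  [/\ K \in unitmx,
      ustar = invmx K *m (lambda *: (Hu^T *m F^T)) *m (mud - F *m Gamma *m mu0),
      forall u T, optimal_pair A B G mu0 mud S0 Sd Sw lambda u T -> u = ustar,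
      causal Tstar &
      exists Psi : 'I_N -> 'I_N.+1 -> 'M[R]_(nu, nx),
        2 *: (Tstar *m St)
        + (2 * lambda) *: (Hu^T *m F^T *m F *m (1%:M + Hu *m Tstar) *m St)
        - (2 * lambda) *: (Hu^T *m F^T *m Sdh
            *m sqrtmx (invmx Sdh *m invmx (Om *m St *m Om^T) *m invmx Sdh)
            *m Sdh *m Om *m St)
        + \sum_(i < N) \sum_(j < N.+1 | (i < j)%N)
            ((Eu i)^T *m Psi i j *m Ex j) = 0].
Proof.
move=> F Gamma Hu St Om Sdh K.
have uK : K \in unitmx := posdefmx_unit (feedforward_posdef A B lambda_gt0).
have uE u T : optimal_pair A B G mu0 mud S0 Sd Sw lambda u T ->
    u = invmx K *m (lambda *: (Hu^T *m F^T)) *m (mud - F *m Gamma *m mu0).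
  by move=> optu; rewrite -mulmxA -(feedforward_foc optu) mulKmx.
split=> //.
- exact: uE opt.
- by move=> u T /uE ->; rewrite -(uE _ _ opt).
- by case: opt.
- exact: causal_multipliers
    (feedback_foc N_ge1 G_full S0_pd Sd_pd Sw_pd lambda_gt0 opt).
Qed.
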